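(* Let $n\ge 1$ and let $\mathbf{w}\in\mathcal{K}_{m+}\setminus\{\mathbf{0}\}\subset\mathbb{R}^n$. For $i=1,\dots,n$ let $$\tau_i=\Bigl(\sum_{j=1}^i w_j\Bigr)^{-1},\qquad \mathbf{b}^{(i)}=[\,\underbrace{\tau_i,\dots,\tau_i}_{i\text{ entries}},0,\dots,0\,]^T\in\mathbb{R}^n,$$ let $\mathcal{B}=\{\mathbf{b}^{(1)},\dots,\mathbf{b}^{(n)}\}$, and let $$\mathcal{A}=\{\mathbf{Q}\,\mathbf{b}:\ \mathbf{Q}\in\mathcal{P}_{\pm},\ \mathbf{b}\in\mathcal{B}\}.$$ Then, for every $\mathbf{x}\in\mathbb{R}^n$, $\ \|\mathbf{x}\|_{\mathcal{A}}=\Omega_{\mathbf{w}}(\mathbf{x})$.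
   Context: $\mathcal{K}_{m+}=\{\mathbf{x}\in\mathbb{R}^n: x_1\ge x_2\ge\cdots\ge x_n\ge 0\}$ is the monotone non-negative cone. The ordered weighted $\ell_1$ (OWL) norm with weights $\mathbf{w}\in\mathcal{K}_{m+}$ is $\Omega_{\mathbf{w}}(\mathbf{x})=\sum_{i=1}^n w_i\,|x|_{[i]}$, where $|x|_{[1]}\ge|x|_{[2]}\ge\cdots\ge|x|_{[n]}$ are the absolute values of the components of $\mathbf{x}$ sorted in non-increasing order. $\mathcal{P}_{\pm}$ is the group of $n\times n$ signed permutation matrices, i.e., matrices with entries in $\{0,-1,+1\}$ such that the sum of absolute values in each row and in each column equals $1$. For a set of atoms $\mathcal{A}\subset\mathbb{R}^n$, the atomic norm is $\|\mathbf{x}\|_{\mathcal{A}}=\inf\{t\ge 0:\ \mathbf{x}\in t\,\mathrm{conv}(\mathcal{A})\}$, where $\mathrm{conv}$ denotes the convex hull. *)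

(* Defs.v *)
From mathcomp Require Import all_boot all_order all_algebra.
From mathcomp Require Import boolp classical_sets reals constructive_ereal ereal.
From mathcomp Require Import convex.

Set Implicit Arguments.
Unset Strict Implicit.
Unset Printing Implicit Defensive.

Import Order.TTheory GRing.Theory Num.Theory.

Local Open Scope classical_set_scope.
Local Open Scope ring_scope.

(* Vectors of R^n are columns 'cV[R]_n; indices are shifted to 0, ..., n-1. *)

Definition mono_nonneg_cone (R : realType) (n : nat) : set 'cV[R]_n :=
  [set x | (forall i j : 'I_n, (i <= j)%N -> x j 0 <= x i 0) /\
           (forall i : 'I_n, 0 <= x i 0)].

Definition sorted_abs (R : realType) (n : nat) (x : 'cV[R]_n) : seq R :=
  sort >=%R [seq `|x i 0| | i <- enum 'I_n].

Definition owl_norm (R : realType) (n : nat) (w x : 'cV[R]_n) : R :=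
  \sum_(i < n) w i 0 * (sorted_abs x)`_i.

Definition signed_perm_mx (R : realType) (n : nat) : set 'M[R]_n :=
  [set Q | [/\ forall i j, Q i j \in [:: 0; -1; 1],
               forall i, \sum_(j < n) `|Q i j| = 1
             & forall j, \sum_(i < n) `|Q i j| = 1]].

Definition convex_hull (R : realType) (n : nat) (A : set 'cV[R]_n) :
    set 'cV[R]_n :=
  smallest (@convex_set R 'cV[R]_n) A.

(* The infimum is taken in the extended reals, so that the atomic norm is +oo
   (and not a default real value) at a point that lies in no t * conv(A). *)
Definition atomic_norm (R : realType) (n : nat) (A : set 'cV[R]_n)
    (x : 'cV[R]_n) : \bar R :=
  ereal_inf [set t%:E | t in
    [set t : R | 0 <= t /\ [set t *: y | y in convex_hull A] x]].

Definition owl_tau (R : realType) (n : nat) (w : 'cV[R]_n) (i : 'I_n) : R :=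
  (\sum_(j < n | (j <= i)%N) w j 0)^-1.

(* For i : 'I_n, the vector with i.+1 leading entries owl_tau w i. *)
Definition owl_b (R : realType) (n : nat) (w : 'cV[R]_n) (i : 'I_n) :
    'cV[R]_n :=
  \col_(k < n) (if (k <= i)%N then owl_tau w i else 0).

Definition owl_B (R : realType) (n : nat) (w : 'cV[R]_n) : set 'cV[R]_n :=
  range (owl_b w).

Definition owl_atoms (R : realType) (n : nat) (w : 'cV[R]_n) : set 'cV[R]_n :=
  [set Q *m b | Q in @signed_perm_mx R n & b in owl_B w].

(* Main.v *)
(* Let [p] be a permutation sorting the absolute values of [x] as s_0 >= s_1 >= ...
   Lower bound: y |-> \sum_i w_i |y_(p i)| is convex, at most 1 on the atoms
   (a partial sum of k weights is largest for the first k), and equals the OWL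
   norm at [x].
   Upper bound: with W_k = w_0 + ... + w_k and a suitable signed permutation [Q],
   x = \sum_k (s_k - s_(k+1)) W_k Q b_k, and by Abel summation the nonnegative
   coefficients add up to the OWL norm of [x]. *)
Require Import Defs.
From mathcomp Require Import all_boot all_order all_algebra.
From mathcomp Require Import perm interval_inference.
From mathcomp Require Import boolp classical_sets reals constructive_ereal ereal.
From mathcomp Require Import convex.

Import Order.TTheory GRing.Theory Num.Theory.

Local Open Scope classical_set_scope.
Local Open Scope ring_scope.

Lemma convex_setP {R : realType} {M : lmodType R} (A : set M) :
  @convex_set R M A <->
  forall (x y : M) (t : R), 0 <= t <= 1 -> A x -> A y ->
    A (t *: x + (1 - t) *: y).
Proof.
split=> [cA x y t /andP[t0 t1] Ax Ay|cA x y l].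
  by have := cA x y (Itv01 t0 t1); rewrite !inE => /(_ Ax Ay).
by rewrite !inE => Ax Ay; apply: cA => //; rewrite ge0 le1.
Qed.

Lemma convex_set_hull {R : realType} {n : nat} (A : set 'cV[R]_n) :
  @convex_set R 'cV[R]_n (convex_hull A).
Proof.
apply/convex_setP => x y t t01 hx hy C [cC AC].
by apply: (convex_setP C).1 => //; [apply: hx|apply: hy].
Qed.

(** Scaled points merge two at a time: [t1 *: y1 + t2 *: y2] is [t1 + t2] times a convex
    combination. The point [a] serves when the total weight is zero. *)
Lemma convex_set_sum {R : realType} {M : lmodType R} {A : set M}
    {I : finType} {c : I -> R} {f : I -> M} {a : M} :
  @convex_set R M A -> A a -> (forall i, 0 <= c i) -> (forall i, A (f i)) ->
  exists2 y, A y & \sum_i c i *: f i = (\sum_i c i) *: y.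
Proof.
move=> /convex_setP cA Aa c0 Af.
suff [] : 0 <= \sum_i c i /\
  exists2 y, A y & \sum_i c i *: f i = (\sum_i c i) *: y by [].
apply: (big_ind2 (fun v t => 0 <= t /\ exists2 y, A y & v = t *: y)).
- by split=> //; exists a; rewrite ?scale0r.
- move=> _ t1 _ t2 [t1_ge0 [y1 Ay1 ->]] [t2_ge0 [y2 Ay2 ->]].
  have t_ge0 : 0 <= t1 + t2 by exact: addr_ge0.
  split=> //; have [t_eq0|t_neq0] := eqVneq (t1 + t2) 0.
    move/eqP: t_eq0; rewrite paddr_eq0// => /andP[/eqP-> /eqP->].
    by exists a; rewrite // addr0 !scale0r addr0.
  exists ((t1 / (t1 + t2)) *: y1 + (1 - t1 / (t1 + t2)) *: y2).
    apply: cA => //; rewrite divr_ge0//= ler_pdivrMr ?mul1r ?lerDl//.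
    by rewrite lt_def t_neq0.
  rewrite scalerDr !scalerA mulrBr mulr1 mulrCA divff// mulr1.
  by rewrite [t1 + t2]addrC addrK.
- by move=> i _; split=> //; exists (f i).
Qed.

Lemma sum_tail_diff {V : zmodType} (s : nat -> V) (n i : nat) : (i <= n)%N ->
  \sum_(k < n | (i <= k)%N) (s k - s k.+1) = s i - s n.
Proof.
move=> le_in.
rewrite -(big_mkord (fun k => (i <= k)%N) (fun k => s k - s k.+1)).
rewrite (big_cat_nat (leq0n i) le_in)//= big_nat_cond big1 ?add0r; last first.
  by move=> k /andP[/andP[_ ki] ik]; rewrite ltnNge ik in ki.
rewrite big_nat_cond (eq_bigl (fun k => (i <= k < n)%N)); last first.
  by move=> k; case: (i <= k)%N; rewrite ?andbT ?andbF.
rewrite -big_nat -opprB -(telescope_sumr s)// -sumrN.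
by apply: eq_bigr => k _; rewrite opprB.
Qed.

(** After exchanging the sums, the factor of [w j] is a tail telescoping to [s j - s n]. *)
Lemma sum_abel {R : pzRingType} (n : nat) (w : 'I_n -> R) (s : nat -> R) :
  s n = 0 ->
  \sum_(k < n) (s k - s k.+1) * (\sum_(j < n | (j <= k)%N) w j) =
  \sum_(j < n) s j * w j.
Proof.
move=> sn0; under eq_bigr do rewrite mulr_sumr.
rewrite (exchange_big_dep predT)//=; apply: eq_bigr => j _.
by rewrite -mulr_suml sum_tail_diff ?sn0 ?subr0// ltnW.
Qed.

Lemma size_sorted_abs {R : realType} {n : nat} (x : 'cV[R]_n) :
  size (sorted_abs x) = n.
Proof. by rewrite size_sort size_map size_enum_ord. Qed.

Lemma sorted_abs_perm {R : realType} {n : nat} (x : 'cV[R]_n) :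
  exists p : 'S_n, forall i : 'I_n, (sorted_abs x)`_i = `|x (p i) 0|.
Proof.
have /tuple_permP[p xp] :
    perm_eq (sorted_abs x) [tuple `|x i 0| | i < n].
  by rewrite /sorted_abs perm_sort.
exists p => i; rewrite xp.
by rewrite -(tnth_nth 0 _ i) !tnth_mktuple.
Qed.

Lemma sorted_abs_ge0 {R : realType} {n : nat} (x : 'cV[R]_n) (k : nat) :
  0 <= (sorted_abs x)`_k.
Proof.
have [kn|nk] := ltnP k n; last by rewrite nth_default// size_sorted_abs.
have [p xp] := sorted_abs_perm x.
by rewrite -[k]/(nat_of_ord (Ordinal kn)) xp.
Qed.

Lemma sorted_abs_noninc {R : realType} {n : nat} (x : 'cV[R]_n) (k : nat) :
  (sorted_abs x)`_k.+1 <= (sorted_abs x)`_k.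
Proof.
(* Past the end, the left side is the default value 0 of [nth]. *)
have [kn|nk] := ltnP k.+1 n; last first.
  by rewrite [leLHS]nth_default ?sorted_abs_ge0// size_sorted_abs.
have ge_total : total (>=%R : rel R) by move=> a b; exact: le_total.
by have /sortedP := sort_sorted ge_total [seq `|x i 0| | i <- enum 'I_n];
  apply; rewrite size_sorted_abs.
Qed.

Section OWL.
Context {R : realType} {n : nat} {w : 'cV[R]_n}.
Hypotheses (w_cone : mono_nonneg_cone w) (w_neq0 : w <> 0).

(** Otherwise the first weight, which is the largest, would vanish, and [w] with it. Hence [owl_tau]
    is a genuine inverse. *)
Lemma sum_head_gt0 (k : 'I_n) : 0 < \sum_(j < n | (j <= k)%N) w j 0.
Proof.
have [w_mono w_ge0] := w_cone.
rewrite lt_def sumr_ge0 ?andbT//; apply/eqP => /psumr_eq0P sum0.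
apply: w_neq0; apply/matrixP => i j; rewrite (ord1 j) mxE.
have n_gt0 : (0 < n)%N by exact: leq_trans (ltn_ord k).
apply/eqP; rewrite eq_le w_ge0 andbT.
by rewrite -(sum0 (fun i _ => w_ge0 i) (Ordinal n_gt0))// w_mono.
Qed.

(* With [e] the indicator of the first [k.+1] indices, every term of
   [\sum_i (w i - w k) * (v i - e i)] is nonpositive. *)
Lemma sum_le_head (k : 'I_n) (v : 'I_n -> R) :
  (forall i, 0 <= v i <= 1) ->
  \sum_(i < n) v i = \sum_(i < n | (i <= k)%N) 1 ->
  \sum_(i < n) w i 0 * v i <= \sum_(i < n | (i <= k)%N) w i 0.
Proof.
move=> v01 v_sum; have [w_mono _] := w_cone.
pose e (i : 'I_n) : R := (i <= k)%N%:R.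
have e_sum : \sum_(i < n) e i = \sum_(i < n) v i.
  by rewrite v_sum [RHS]big_mkcond; apply: eq_bigr => i _; rewrite /e; case: leqP.
have -> : \sum_(i < n | (i <= k)%N) w i 0 = \sum_(i < n) w i 0 * e i.
  rewrite big_mkcond; apply: eq_bigr => i _.
  by rewrite /e; case: leqP; rewrite ?mulr1 ?mulr0.
have : \sum_(i < n) (w i 0 - w k 0) * (v i - e i) <= 0.
  apply: sumr_le0 => i _; have /andP[v0 v1] := v01 i.
  rewrite /e; case: leqP => [ik|/ltnW ki].
    by rewrite mulr_ge0_le0 ?subr_ge0 ?subr_le0 ?w_mono.
  by rewrite mulr_le0_ge0 ?subr0 ?subr_le0 ?w_mono.
(* The terms in [w k] cancel because [v] and [e] have equal totals. *)
under eq_bigr do rewrite mulrBl [w k 0 * _]mulrBr [w _ 0 * _]mulrBr.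
by rewrite !sumrB -!mulr_sumr e_sum subrr subr0 subr_le0.
Qed.

Lemma owl_atom_le1 (p : 'S_n) (a : 'cV[R]_n) :
  owl_atoms w a -> \sum_(i < n) w i 0 * `|a (p i) 0| <= 1.
Proof.
have [_ w_ge0] := w_cone.
move=> [Q [_ Qrow Qcol] [_ [k _ <-] <-]].
(* The row sums of [Q] give [v i <= 1]; its column sums make [v] total [k.+1], as [sum_le_head]
   requires. *)
pose v i := \sum_(j < n | (j <= k)%N) `|Q (p i) j|.
have W_gt0 := sum_head_gt0 k.
have tau_ge0 : 0 <= owl_tau w k by rewrite invr_ge0 ltW.
have abs_le i : `|(Q *m owl_b w k) (p i) 0| <= v i * owl_tau w k.
  rewrite mxE (le_trans (ler_norm_sum _ _ _))// /v mulr_suml [leRHS]big_mkcond.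
  apply: ler_sum => j _; rewrite !mxE normrM.
  by case: ifP => _; rewrite ?normr0 ?mulr0// (ger0_norm tau_ge0).
have -> : 1 = (\sum_(i < n | (i <= k)%N) w i 0) * owl_tau w k.
  by rewrite divff// gt_eqF.
apply: le_trans (_ : (\sum_(i < n) w i 0 * v i) * owl_tau w k <= _).
  rewrite mulr_suml; apply: ler_sum => i _.
  by rewrite -mulrA ler_wpM2l.
rewrite ler_wpM2r// sum_le_head// => [i|].
  rewrite sumr_ge0//= -(Qrow (p i)) /v big_mkcond; apply: ler_sum => j _.
  by case: ifP.
rewrite /v exchange_big; apply: eq_bigr => j _.
by rewrite -(Qcol j) [RHS](reindex_inj (@perm_inj _ p)).
Qed.

(** A sublevel set of a convex function is convex, so the bound passes from the atoms to their
    hull. *)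
Lemma owl_hull_le1 (p : 'S_n) (y : 'cV[R]_n) :
  convex_hull (owl_atoms w) y -> \sum_(i < n) w i 0 * `|y (p i) 0| <= 1.
Proof.
have [_ w_ge0] := w_cone.
pose X : set 'cV[R]_n := [set y | \sum_(i < n) w i 0 * `|y (p i) 0| <= 1].
suff cX : @convex_set R 'cV[R]_n X.
  exact: (smallest_sub cX (fun a => @owl_atom_le1 p a)).
apply/convex_setP => x z t /andP[t0 t1] /= x1 z1.
have t'0 : 0 <= 1 - t by rewrite subr_ge0.
rewrite /X/= [leRHS](_ : _ = t * 1 + (1 - t) * 1); last first.
  by rewrite !mulr1 subrKC.
apply: le_trans (lerD (ler_wpM2l t0 x1) (ler_wpM2l t'0 z1)).
rewrite !mulr_sumr -big_split/=; apply: ler_sum => i _.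
rewrite !mxE !(mulrCA _ (w i 0)) -mulrDr ler_wpM2l//.
by rewrite (le_trans (ler_normD _ _))// !normrM (ger0_norm t0) (ger0_norm t'0).
Qed.

Lemma owl_norm_le (x y : 'cV[R]_n) (t : R) : 0 <= t ->
  (* The permutation sorts [t *: y] rather than [y]; the factor [t] then comes out of the absolute
     values. *)
  convex_hull (owl_atoms w) y -> t *: y = x -> owl_norm w x <= t.
Proof.
move=> t_ge0 hy <-; have [p yp] := sorted_abs_perm (t *: y).
rewrite /owl_norm; under eq_bigr do rewrite yp mxE normrM (ger0_norm t_ge0) mulrCA.
by rewrite -mulr_sumr ler_piMr// owl_hull_le1.
Qed.

Lemma owl_norm_hull (x : 'cV[R]_n) : (1 <= n)%N ->
  0 <= owl_norm w x /\
  exists2 y, convex_hull (owl_atoms w) y & owl_norm w x *: y = x.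
Proof.
move=> n_ge1; have [_ w_ge0] := w_cone.
have [p xp] := sorted_abs_perm x.
split; first by apply: sumr_ge0 => i _; rewrite mulr_ge0// sorted_abs_ge0.
pose s := nth 0 (sorted_abs x).
have sn0 : s n = 0 by rewrite /s nth_default// size_sorted_abs.
(* [Q] moves rank [p^-1 i] to position [i] with the sign of [x i 0]; a zero entry gets sign 1, so
   its row keeps a nonzero entry. *)
pose Q : 'M[R]_n :=
  \matrix_(i, j) ((-1) ^+ (x i 0 < 0)%R * (p^-1%g i == j)%:R).
have absQ i j : `|Q i j| = (p^-1%g i == j)%:R.
  by rewrite mxE normrM normr_sign mul1r normr_nat.
have Qperm : signed_perm_mx Q.
  split=> [i j|i|j].
  - rewrite mxE; case: eqP; rewrite ?mulr0 ?mulr1 ?inE ?eqxx//.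
    by case: (_ < _); rewrite ?expr0 ?expr1 eqxx ?orbT.
  - rewrite (bigD1 (p^-1%g i))//= absQ eqxx big1 ?addr0// => j.
    by rewrite absQ eq_sym => /negPf->.
  - rewrite (bigD1 (p j))//= absQ permK eqxx big1 ?addr0// => i.
    by rewrite absQ (canF_eq (permKV p)) => /negPf->.
have QE (b : 'cV[R]_n) i :
    (Q *m b) i 0 = (-1) ^+ (x i 0 < 0)%R * b (p^-1%g i) 0.
  rewrite mxE (bigD1 (p^-1%g i))//= mxE eqxx mulr1 big1 ?addr0// => j.
  by rewrite mxE eq_sym => /negPf->; rewrite mulr0 mul0r.
pose W (k : 'I_n) := \sum_(j < n | (j <= k)%N) w j 0.
have Qb_atom k : convex_hull (owl_atoms w) (Q *m owl_b w k).
  by apply: sub_gen_smallest; exists Q => //; exists (owl_b w k) => //; exists k.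
have c_ge0 (k : 'I_n) : 0 <= (s k - s k.+1) * W k.
  by rewrite mulr_ge0 ?subr_ge0 ?sorted_abs_noninc// ltW ?sum_head_gt0.
(* The first atom, available since [n >= 1], covers the case of zero total weight. *)
have [y hy] := convex_set_sum (convex_set_hull _)
  (Qb_atom (Ordinal n_ge1)) c_ge0 Qb_atom.
have -> : \sum_(k < n) (s k - s k.+1) * W k = owl_norm w x.
  by rewrite sum_abel//; apply: eq_bigr => j _; rewrite mulrC.
move=> xE; exists y; rewrite // -xE.
apply/matrixP => i j; rewrite (ord1 j) summxE.
under eq_bigr => k _ do rewrite mxE QE mulrCA mxE.
rewrite -mulr_sumr.
(* [W k] cancels [owl_tau w k], leaving a telescoping tail from the rank of [x i 0]. *)
have -> : \sum_(k < n) (s k - s k.+1) * W k *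
    (if (p^-1%g i <= k)%N then owl_tau w k else 0) = s (p^-1%g i).
  have /ltnW/(sum_tail_diff s) := ltn_ord (p^-1%g i).
  rewrite sn0 subr0 => <-; rewrite [RHS]big_mkcond.
  apply: eq_bigr => k _; case: ifP => _; last by rewrite mulr0.
  by rewrite mulfK// gt_eqF// sum_head_gt0.
by rewrite /s xp permKV -numEsign.
Qed.

End OWL.

Theorem theorem1 (R : realType) (n : nat) (w : 'cV[R]_n)
    (n_ge1 : (1 <= n)%N)
    (w_cone : mono_nonneg_cone w) (w_neq0 : w <> 0)
    (x : 'cV[R]_n) :
  atomic_norm (owl_atoms w) x = (owl_norm w x)%:E.
Proof.
apply/eqP; rewrite eq_le; apply/andP; split.
  (* The infimum is attained at the OWL norm itself. *)
  by apply: ereal_inf_lbound; exists (owl_norm w x) => //; exact: owl_norm_hull.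
apply: le_ereal_inf_tmp => _ [t [t_ge0 [y hy yx]] <-].
by rewrite lee_fin (owl_norm_le w_cone w_neq0 _ y).
Qed.
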